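(* Let $X$ be a continuous random variable with cumulative distribution function $F_X$, continuous and strictly increasing on the support of $X$, and probability density function $f_X$. Let $k\ge 1$ be a fixed integer. If the density $f_X(x)$ is increasing in $x$ (on the support of $X$), then $H(f_{U_{n,k}},f_X)$ is decreasing in $n$; that is, $H(f_{U_{n,k}},f_X)\ge H(f_{U_{n+1,k}},f_X)$ for every integer $n\ge 1$.
   Context: Write $\bar F_X=1-F_X$. For positive integers $n,k$, the $n$th upper $k$-record value $U_{n,k}$ from the distribution of $X$ has probability density function $$f_{U_{n,k}}(x)=\frac{k^n}{(n-1)!}\,[-\log \bar F_X(x)]^{n-1}\,[\bar F_X(x)]^{k-1} f_X(x).$$ The Kerridge inaccuracy measure between $U_{n,k}$ and $X$ is $$H(f_{U_{n,k}},f_X)=-\int_{-\infty}^{\infty} f_{U_{n,k}}(x)\log f_X(x)\,dx,$$ where the integral is taken over the support of $X$ and is assumed to be well defined. ''Increasing'' and ''decreasing'' are meant in the non-strict sense. *)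

(* Defs.v *)
From mathcomp Require Import all_boot all_order all_algebra.
From mathcomp Require Import all_classical all_reals all_analysis.

Set Implicit Arguments.
Unset Strict Implicit.
Unset Printing Implicit Defensive.

Import Order.TTheory GRing.Theory Num.Theory.
Import numFieldNormedType.Exports.

Local Open Scope classical_set_scope.
Local Open Scope ring_scope.

(* [f] is a version of the density of [X] with respect to Lebesgue measure. *)
Definition is_pdf (d : measure_display) (T : measurableType d) (R : realType)
    (P : probability T R) (X : {RV P >-> R}) (f : R -> R) : Prop :=
  [/\ measurable_fun [set: R] f,
      (forall x, 0 <= f x) &
      (forall A : set R, measurable A ->
        distribution P X A = (\int[lebesgue_measure]_(x in A) (f x)%:E)%E)].

(* The library's [cdf] takes its values in the extended reals. *)
Definition cdfR (d : measure_display) (T : measurableType d) (R : realType)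
    (P : probability T R) (X : {RV P >-> R}) (x : R) : R := fine (cdf X x).

(* The support set of a density, in the sense usual for differential entropies:
   the set where the density is positive, as opposed to its closure. *)
Definition pdf_support (R : realType) (f : R -> R) : set R := [set x | 0 < f x].

(* Only meaningful for [0 < n] and [0 < k].  Where [F x = 1] the value [ln 0 = 0]
   is irrelevant, since [f] is almost everywhere zero there. *)
Definition record_pdf (R : realType) (F f : R -> R) (n k : nat) (x : R) : R :=
  k%:R ^+ n / (n.-1)`!%:R * (- ln (1 - F x)) ^+ n.-1 * (1 - F x) ^+ k.-1 * f x.

Definition kerridge_integrand (R : realType) (g f : R -> R) (x : R) : \bar R :=
  (g x * ln (f x))%:E.

Definition kerridge (R : realType) (g f : R -> R) : \bar R :=
  (- \int[lebesgue_measure]_(x in pdf_support f) kerridge_integrand g f x)%E.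

(* The integral exists in the extended reals: it is not of the form oo - oo. *)
Definition kerridge_well_defined (R : realType) (g f : R -> R) : Prop :=
  (\int[lebesgue_measure]_(x in pdf_support f)
      ((kerridge_integrand g f)^\+ x) < +oo)%E \/
  (\int[lebesgue_measure]_(x in pdf_support f)
      ((kerridge_integrand g f)^\- x) < +oo)%E.

(* Main.v *)
Require Import Defs.
From HB Require Import structures.
From mathcomp Require Import all_boot all_order all_algebra.
From mathcomp Require Import all_classical all_reals all_analysis.
From mathcomp Require Import measurable_realfun ring lra.

Import Order.TTheory GRing.Theory Num.Theory.
Import numFieldNormedType.Exports.

Local Open Scope classical_set_scope.
Local Open Scope ring_scope.

(* The cumulative hazard V = - ln (1 - F) satisfies
     f_{U_{n+1,k}} = f_{U_{n,k}} * (k V / n),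
   so the difference of the two densities changes sign exactly once, from
   negative to positive, when V crosses n / k.  As ln f is increasing, there is
   a constant c (the supremum of ln f before the crossing) such that
   (f_{U_{n+1,k}} - f_{U_{n,k}}) (ln f - c) >= 0.  Integrating this gives the
   claim since both densities have total mass 1: the law of V(X) is exponential
   with rate 1, and the mass of f_{U_{n,k}} becomes that of the Erlang density
   with parameters n and k. *)

(** * Change of measure through a density *)

(** [f] and the Radon-Nikodym derivative of [nu] have the same integral over every measurable set,
    hence agree almost everywhere, and the change of variables for the derivative carries over to
    [f]. *)
Lemma ge0_integral_density (d : measure_display) (T : measurableType d)
    (R : realType)
    (mu : {sigma_finite_measure set T -> \bar R})
    (nu : {finite_measure set T -> \bar R}) (f : T -> R) (h : T -> \bar R) :
  measurable_fun [set: T] f -> (forall x, 0 <= f x) ->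
  (forall A, measurable A -> nu A = (\int[mu]_(x in A) (f x)%:E)%E) ->
  measurable_fun [set: T] h -> (forall x, 0 <= h x)%E ->
  (\int[nu]_x h x = \int[mu]_x (h x * (f x)%:E))%E.
Proof.
move=> mf f0 nuE mh h0.
have mfE : measurable_fun setT (EFin \o f) by exact/measurable_EFinP.
have numu : (nu `<< mu)%E.
  apply/null_content_dominatesP => A mA muA0; rewrite nuE//.
  by apply: null_set_integral => //; exact: measurable_funTS.
have RNf : ae_eq mu setT (Radon_Nikodym_SigmaFinite.f nu mu) (EFin \o f).
  apply: integral_ae_eq => //.
  - exact: Radon_Nikodym_SigmaFinite.f_integrable.
  - by move=> A _ mA; rewrite -Radon_Nikodym_SigmaFinite.f_integral// nuE.
rewrite -(Radon_Nikodym_SigmaFinite.change_of_variables numu)//.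
apply: ae_eq_integral => //.
- apply: emeasurable_funM => //.
  exact: measurable_int (Radon_Nikodym_SigmaFinite.f_integrable _).
- exact: emeasurable_funM.
- exact: ae_eqe_mul2l.
Qed.

(** * Poisson probabilities and the Erlang density *)

(** The exponential series gives [x ^+ n.+1 / n.+1]! <= expR x[for positive]x[, so the function is
    squeezed between 0 and]n.+1[! / x]. *)
Lemma cvg_exprn_expRN (R : realType) (n : nat) :
  x ^+ n * expR (- x) @[x --> +oo] --> (0 : R).
Proof.
have H : (n.+1)`!%:R * x^-1 @[x --> +oo] --> (0 : R).
  rewrite -(mulr0 ((n.+1)`!%:R : R)); apply: cvgMl_tmp.
  apply/(gtr0_cvgV0 (f := id)); last exact: cvg_id.
  exact: nbhs_pinfty_gt.
apply: (squeeze_cvgr _ (cvg_cst 0) H).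
near=> x.
have x0 : 0 < x by near: x; exact: nbhs_pinfty_gt.
rewrite mulr_ge0 ?exprn_ge0 ?expR_ge0 ?(ltW x0)//=.
rewrite expRN ler_pdivrMr ?expR_gt0// mulrAC ler_pdivlMr// -exprSr.
rewrite -ler_pdivrMl ?ltr0n ?fact_gt0//.
apply: le_trans (expR_ge1Dxn n (ltW x0)).
by rewrite mulrC lerDr.
Unshelve. all: by end_near. Qed.

Definition poisson_term {R : realType} (i : nat) (x : R) : R :=
  i`!%:R^-1 * x ^+ i * expR (- x).

(** The probability that a Poisson variable of mean [x] is strictly less than [n]. *)
Definition poisson_cdf {R : realType} (n : nat) (x : R) : R :=
  \sum_(i < n) poisson_term i x.

Lemma is_derive_poisson_term (R : realType) (i : nat) (x : R) :
  is_derive x 1 (poisson_term i)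
    ((if i is j.+1 then poisson_term j x else 0) - poisson_term i x).
Proof.
rewrite (_ : poisson_term i = cst i`!%:R^-1 * id ^+ i * (expR \o -%R)).
  apply: is_derive_eq.
  rewrite !fctE /GRing.scale/= /poisson_term; case: i => [|i].
    by ring.
  rewrite factS natrM invfM /=.
  by field; rewrite nat1r !pnatr_eq0 -lt0n fact_gt0.
by apply/funext => y; rewrite !fctE.
Qed.

(** The derivatives of the terms telescope, and only the last term survives. *)
Lemma is_derive_poisson_cdf (R : realType) (n : nat) (x : R) :
  is_derive x 1 (poisson_cdf n.+1) (- poisson_term n x).
Proof.
elim: n => [|n IHn].
  rewrite (_ : poisson_cdf 1 = poisson_term 0).
    by have := is_derive_poisson_term R 0 x; rewrite sub0r.
  by apply/funext => y; rewrite /poisson_cdf big_ord1.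
rewrite (_ : poisson_cdf n.+2 = poisson_cdf n.+1 + poisson_term n.+1).
  have := is_derive_poisson_term R n.+1 x => ?.
  by apply: is_derive_eq; rewrite addrA addNr add0r.
by apply/funext => y; rewrite /poisson_cdf big_ord_recr.
Qed.

Lemma cvg_poisson_cdfy (R : realType) (n : nat) :
  poisson_cdf n x @[x --> +oo] --> (0 : R).
Proof.
elim: n => [|n IHn].
  rewrite (_ : poisson_cdf 0 = cst 0); first exact: cvg_cst.
  by apply/funext => y; rewrite /poisson_cdf big_ord0.
rewrite (_ : poisson_cdf n.+1 = poisson_cdf n \+ poisson_term n).
  rewrite -[0]addr0; apply: cvgD => //.
  rewrite -(mulr0 (n`!%:R^-1)) /poisson_term.
  under eq_fun do rewrite -mulrA.
  by apply: cvgMl_tmp; exact: cvg_exprn_expRN.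
by apply/funext => y; rewrite /poisson_cdf big_ord_recr.
Qed.

Lemma continuous_poisson_term (R : realType) (n : nat) :
  continuous (@poisson_term R n).
Proof.
move=> x; have [? _] := is_derive_poisson_term R n x.
exact/differentiable_continuous/derivable1_diffP.
Qed.

(** The integrand is the Erlang density of shape [n.+1] and rate [r]. Its antiderivative
    [- poisson_cdf n.+1 (r * x)] rises from -1 at 0, where only the term of index 0 is nonzero, to 0
    at infinity. *)
Lemma integral_erlang (R : realType) (r : R) (n : nat) : 0 < r ->
  (\int[lebesgue_measure]_(x in `[0%R, +oo[)
    (r * poisson_term n (r * x))%:E = 1)%E.
Proof.
move=> r0.
have dF (x : R) : is_derive x 1 (fun x => - poisson_cdf n.+1 (r * x))
    (r * poisson_term n (r * x)).
  have -> : (fun x => - poisson_cdf n.+1 (r * x)) =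
      - (poisson_cdf n.+1 \o (r \*: id)) by [].
  have := is_derive_poisson_cdf R n (r * x) => ?.
  by apply: is_derive_eq; rewrite /GRing.scale/= mulr1 mulNr opprK mulrC.
have cr : continuous ( *%R r) by exact: mulrl_continuous.
rewrite (@ge0_continuous_FTC2y _ _
  (fun x => - poisson_cdf n.+1 (r * x)) _ 0)//.
- rewrite mulr0 /poisson_cdf big_ord_recl big1 ?addr0.
    rewrite /poisson_term fact0 invr1 oppr0 expR0 expr0 !mul1r.
    by rewrite EFinN oppeK add0e.
  by move=> i _; rewrite /poisson_term expr0n/= mulr0 mul0r.
- move=> x x0; have rx0 : 0 <= r * x by rewrite mulr_ge0// ltW.
  by rewrite /poisson_term !mulr_ge0 ?invr_ge0 ?exprn_ge0 ?expR_ge0// ltW.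
- apply: continuous_subspaceT => x; apply: cvgMl_tmp.
  by apply: continuous_comp; [exact: cr|exact: continuous_poisson_term].
- rewrite -oppr0; apply: cvgN.
  apply: (cvg_comp _ _ _ (cvg_poisson_cdfy R n.+1)).
  exact: gt0_cvgMry.
- apply/cvg_at_right_filter.
  have [dF0 _] := dF 0.
  exact: (differentiable_continuous ((@derivable1_diffP _ _ _ _).1 dF0)).
- by move=> x _; rewrite derive1E; exact: derive_val.
Qed.

(** * Laws of the distribution function and of the cumulative hazard *)

Section cdf_transform.
Context {d : measure_display} {T : measurableType d} {R : realType}
  {P : probability T R}.
Variable X : {RV P >-> R}.
Local Notation mu := (distribution P X).
Local Notation F := (cdfR X).

Lemma cdfRE x : (F x)%:E = mu `]-oo, x].
Proof. by rewrite /cdfR /cdf fineK// fin_num_measure. Qed.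

Lemma cdfR_ge0 x : 0 <= F x.
Proof. by rewrite -lee_fin cdfRE. Qed.

Lemma cdfR_le1 x : F x <= 1.
Proof. by rewrite -lee_fin cdfRE; exact: cdf_le1. Qed.

Lemma cdfR_nondecreasing : {homo F : x y / x <= y}.
Proof. by move=> x y xy; rewrite -lee_fin !cdfRE; exact: cdf_nondecreasing. Qed.

Lemma measurable_cdfR : measurable_fun [set: R] F.
Proof. exact: nondecreasing_measurable cdfR_nondecreasing. Qed.

Lemma measurable_cdfR_le t : measurable [set x | F x <= t].
Proof.
rewrite -[X in measurable X]setTI.
rewrite (_ : [set x | F x <= t] = F @^-1` `]-oo, t]); last first.
  by apply/seteqP; split=> x /=; rewrite in_itv.
exact: measurable_cdfR.
Qed.

Hypothesis mu1 : forall x, mu [set x] = 0%E.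

(** The probability integral transform. With [s] the supremum of [A], the set [A] lies between
    []-oo, s[] and []-oo, s]], which have the same mass [F s] as there are no atoms. Right
    continuity gives [t <= F s], and left approximation gives [F s <= t]. *)
Lemma distribution_cdfR_le (t : R) : 0 < t < 1 -> mu [set x | F x <= t] = t%:E.
Proof.
move=> /andP[t0 t1]; set A := [set x | F x <= t].
have [a Aa] : A !=set0.
  have cF : F x @[x --> -oo] --> (0 : R) by apply: fine_cvg; exact: cvg_cdfNy0.
  have /filter_ex[a Fa] : \forall x \near -oo, F x < t by exact: (cvgr_lt _ cF).
  by exists a; exact: ltW.
have [b bA] : exists b, ubound A b.
  have cF : F x @[x --> +oo] --> (1 : R) by apply: fine_cvg; exact: cvg_cdfy1.
  have /filter_ex[b Fb] : \forall x \near +oo, t < F x by exact: (cvgr_gt _ cF).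
  exists b => x Ax; rewrite leNgt; apply/negP => /ltW /cdfR_nondecreasing.
  by rewrite leNgt (le_lt_trans Ax).
have hubA : has_ubound A by exists b.
pose s := sup A.
have tFs : t <= F s.
  rewrite leNgt; apply/negP => Fst.
  have cF : F x @[x --> s^'+] --> F s.
    by apply: fine_cvg; rewrite cdfRE; exact: cdf_right_continuous.
  near s^'+ => y.
  have : F y < t by near: y; exact: (cvgr_lt _ cF).
  move=> /ltW /(ub_le_sup hubA); rewrite leNgt => /negP; apply.
  by near: y; exact: nbhs_right_gt.
have lts x : x < s -> F x <= t.
  move=> /sup_gt[|y Ay xy]; first by exists a.
  by apply: le_trans Ay; apply/cdfR_nondecreasing/ltW.
have mus : mu `]-oo, s[ = (F s)%:E.
  rewrite cdfRE -(@setUitv1 _ _ -oo%O s true)// measureU//.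
    by rewrite [X in (_ + X)%E]mu1 adde0.
  by rewrite -subset0 => x /=; rewrite in_itv/= => -[/[swap] ->]; rewrite ltxx.
have Fst : F s <= t.
  rewrite -lee_fin -mus.
  (* These rays increase to []-oo, s[], and each has mass at most [t] because its endpoint lies
     below [s]; continuity of the measure from below passes the bound to the union. *)
  pose I n : set R := `]-oo, s - n.+1%:R^-1]%classic.
  have -> : `]-oo, s[%classic = \bigcup_n I n.
    apply/seteqP; split=> [x|x [n _]]; rewrite /I/= !in_itv/=.
      move=> /ltr_add_invr[n xns]; exists n => //=.
      by rewrite in_itv/= lerBrDr ltW.
    by move=> /le_lt_trans; apply; rewrite ltrBlDr ltrDl.
  have cI : mu (I n) @[n --> \oo] --> mu (\bigcup_n I n).
    have mI n : measurable (I n) by exact: measurable_itv.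
    apply: nondecreasing_cvg_mu => //; first exact: bigcup_measurable.
    move=> m n mn; apply/subsetPset/subset_itvl.
    by rewrite bnd_simp lerD2l lerN2 lef_pV2 ?posrE// ler_nat.
  apply: (cvge_le _ cI); apply: nearW => n; rewrite -cdfRE lee_fin; apply: lts.
  by rewrite ltrBlDr ltrDl.
have sA : `]-oo, s[%classic `<=` A by move=> x /=; rewrite in_itv/=; exact: lts.
have As : A `<=` `]-oo, s]%classic.
  by move=> x /(ub_le_sup hubA) /=; rewrite in_itv.
have <- : F s = t by apply/eqP; rewrite eq_le Fst.
apply/eqP; rewrite eq_le -{2}mus cdfRE; apply/andP; split.
  by apply: le_measure; rewrite ?inE//; exact: measurable_cdfR_le.
by apply: le_measure; rewrite ?inE//; exact: measurable_cdfR_le.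
Unshelve. all: by end_near. Qed.

Lemma distribution_cdfR_gt (t : R) : 0 < t < 1 ->
  mu [set x | t < F x] = (1 - t)%:E.
Proof.
move=> t01; rewrite EFinB -(distribution_cdfR_le t t01) -probability_setC.
  by congr (mu _); apply/seteqP; split=> x /=; rewrite ltNge => /negP.
exact: measurable_cdfR_le.
Qed.

Lemma measurable_cdfR_gt t : measurable [set x | t < F x].
Proof.
rewrite (_ : [set x | t < F x] = ~` [set x | F x <= t]).
  by apply: measurableC; exact: measurable_cdfR_le.
by apply/seteqP; split=> x /=; rewrite ltNge => /negP.
Qed.

Lemma measurable_cdfR_eq1 : measurable [set x | F x = 1].
Proof.
rewrite -[X in measurable X]setTI.
by apply: (measurable_cdfR measurableT [set 1]); exact: measurable_set1.
Qed.

(** For every [t] in []0, 1[] the set lies in the set where [t < F x], of mass [1 - t]. *)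
Lemma distribution_cdfR_eq1 : mu [set x | F x = 1] = 0%E.
Proof.
apply/eqP; rewrite -measure_le0; apply/lee_addgt0Pr => e e0; rewrite add0e.
(* The maximum with 1/2 keeps [t] positive even when [1 <= e]. *)
pose t := Num.max 2^-1 (1 - e).
have t01 : 0 < t < 1.
  by rewrite lt_max invr_gt0 ltr0n/= gt_max invf_lt1// ltr1n ltrBlDr ltrDl.
have := distribution_cdfR_gt t t01 => mut.
apply: (@le_trans _ _ (1 - t)%:E); last first.
  by rewrite lee_fin lerBlDr -lerBlDl le_max lexx orbT.
rewrite -mut; apply: le_measure; rewrite ?inE.
- exact: measurable_cdfR_eq1.
- exact: measurable_cdfR_gt.
- by move=> x /= ->; case/andP: t01.
Qed.

(** Since [ln 0 = 0], the value is 0 and not infinity where [F x = 1]. *)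
Definition cumulative_hazard x := - ln (1 - F x).
Local Notation V := cumulative_hazard.

Lemma cumulative_hazard_ge0 x : 0 <= V x.
Proof. by rewrite oppr_ge0 ln_le0// lerBlDr lerDl cdfR_ge0. Qed.

Lemma measurable_cumulative_hazard : measurable_fun [set: R] V.
Proof.
apply: measurableT_comp => //; apply: measurableT_comp => //.
by apply: measurable_funB => //; exact: measurable_cdfR.
Qed.

Lemma expRN_cumulative_hazard x : F x < 1 -> expR (- V x) = 1 - F x.
Proof. by move=> Fx; rewrite opprK lnK// posrE subr_gt0. Qed.

Lemma measurable_cumulative_hazard_gt w : measurable [set x | w < V x].
Proof.
rewrite -[X in measurable X]setTI.
rewrite (_ : [set x | w < V x] = V @^-1` `]w, +oo[); last first.
  by apply/seteqP; split=> x /=; rewrite in_itv/= andbT.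
exact: measurable_cumulative_hazard.
Qed.

Let distribution_cumulative_hazard_gt0 w : 0 < w ->
  mu [set x | w < V x] = (expR (- w))%:E.
Proof.
move=> w0; pose t := 1 - expR (- w).
have t01 : 0 < t < 1.
  by rewrite subr_gt0 expR_lt1 oppr_lt0 w0/= ltrBlDr ltrDl expR_gt0.
have -> : expR (- w) = 1 - t by rewrite /t opprB addrC subrK.
rewrite -(distribution_cdfR_gt t t01).
(* Points with [F x = 1] have [V x = 0] by the convention on [ln 0], so they are missing from the
   set where [w < V x] and form a separate null piece. *)
have E : [set x | t < F x] = [set x | w < V x] `|` [set x | F x = 1].
  apply/seteqP; split=> x /=.
    move=> tFx; have := cdfR_le1 x.
    rewrite le_eqVlt => /predU1P[|Fx1]; first by right.
    left; rewrite -ltrN2 -ltr_expR expRN_cumulative_hazard//.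
    by rewrite ltrBlDr addrC -ltrBlDr.
  move=> [wV|->]; last by case/andP: t01.
  have Fx1 : F x < 1.
    rewrite lt_neqAle cdfR_le1 andbT; apply: contraTneq wV => Fx1.
    by rewrite -leNgt /V Fx1 subrr ln0// oppr0 ltW.
  move: wV; rewrite -ltrN2 -ltr_expR expRN_cumulative_hazard//.
  by rewrite /t ltrBlDr addrC -ltrBlDr.
rewrite E measureU//.
- by rewrite [X in (_ + X)%E]distribution_cdfR_eq1 adde0.
- exact: measurable_cumulative_hazard_gt.
- exact: measurable_cdfR_eq1.
- rewrite -subset0 => x /= [+ Fx1]; rewrite /V Fx1 subrr ln0// oppr0.
  by rewrite ltNge ltW.
Qed.

Lemma distribution_cumulative_hazard_gt w : 0 <= w ->
  mu [set x | w < V x] = (expR (- w))%:E.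
Proof.
rewrite le_eqVlt => /predU1P[<-|]; last first.
  exact: distribution_cumulative_hazard_gt0.
rewrite oppr0 expR0; apply/eqP; rewrite eq_le probability_le1/=; last first.
  exact: measurable_cumulative_hazard_gt.
(* For [w = 0] the level [t] would be 0, outside the range of the transform. The mass is instead at
   least that of the set where [e < V x], which is [expR (- e) >= 1 - e]. *)
apply/lee_subgt0Pr => e e0.
apply: (@le_trans _ _ (expR (- e))%:E).
  by rewrite -EFinB lee_fin; exact: expR_ge1Dx.
rewrite -distribution_cumulative_hazard_gt0//; apply: le_measure; rewrite ?inE.
- exact: measurable_cumulative_hazard_gt.
- exact: measurable_cumulative_hazard_gt.
- by move=> x /=; exact: lt_trans.
Qed.

End cdf_transform.

(** * Exponential tails, and laws on the Borel line *)

Lemma exponential_prob_itvoy (R : realType) (r w : R) : 0 < r -> 0 <= w ->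
  exponential_prob r `]w, +oo[ = (expR (- (r * w)))%:E.
Proof.
move=> r0 w0; rewrite /exponential_prob.
have cF (x : R) : {for x, continuous (fun x => - expR (- r * x))}.
  apply: continuousN; apply: continuous_comp; last exact: continuous_expR.
  exact: mulrl_continuous.
rewrite integral_itv_obnd_cbnd; last first.
  by apply/measurable_EFinP/measurable_funTS; exact: measurable_exponential_pdf.
rewrite (@ge0_continuous_FTC2y _ _ (fun x => - expR (- r * x)) _ 0)//.
- by rewrite EFinN oppeK add0e mulNr.
- by move=> x _; apply: exponential_pdf_ge0; exact: ltW.
- apply: (@continuous_subspaceW R^o _ _ [set` `[0, +oo[%R]).
  + by apply: subset_itvr; rewrite bnd_simp.
  + exact: within_continuous_exponential_pdf.
- rewrite -oppr0; apply: cvgN.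
  under eq_fun do rewrite mulNr.
  by apply: (cvg_comp _ _ _ (@cvgr_expR R)); exact: gt0_cvgMry.
- exact/cvg_at_right_filter/cF.
- move=> x; rewrite in_itv/= andbT => wx.
  by apply: derive1_exponential_pdf; rewrite in_itv/= andbT (le_lt_trans w0).
Qed.

Section borel_random_variable.
Context {d : measure_display} {T : measurableType d} {R : realType}
  {P : probability T R}.
Variable X : {RV P >-> R}.

(* [lebesgue_measure] and [exponential_prob] live on [measurableTypeR R], which
   has the measurable sets of [R] but another display. *)
Let borelX : T -> measurableTypeR R := X.
Let measurable_borelX : measurable_fun [set: T] borelX.
Proof. by move=> mT Y mY; exact: (measurable_funP X mT Y mY). Qed.
HB.instance Definition _ :=
  isMeasurableFun.Build _ _ _ _ borelX measurable_borelX.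
Let Xb : {RV P >-> measurableTypeR R} := borelX.

(** The open upper rays are stable under intersection, generate the Borel sets and cover the line
    along [- n%:R], so finite measures that agree on them are equal. *)
Lemma eq_distribution_itvoy (nu : probability (measurableTypeR R) R) :
  (forall w, distribution P X `]w, +oo[ = nu `]w, +oo[%classic) ->
  forall A, measurable A -> distribution P X A = nu A.
Proof.
move=> munu A mA.
rewrite -[LHS]/(distribution P Xb A).
move: A mA; apply: (@measure_unique _ R (measurableTypeR R) (@RGenOInfty.G R)
  (fun n => `](- n%:R), +oo[%classic)).
- exact: RGenOInfty.measurableE.
- move=> _ _ [x ->] [y ->]; exists (Num.max x y).
  by apply/seteqP; split=> z /=; rewrite !in_itv/= !andbT gt_max => /andP.
- by move=> n; exists (- n%:R).
- rewrite -subTset => x _; exists (Num.truncn (- x)).+1 => //=.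
  by rewrite in_itv/= andbT ltrNl truncnS_gt.
- by move=> _ [x ->]; exact: munu.
- by move=> n; rewrite (le_lt_trans (probability_le1 _ _)) ?ltry.
Qed.

Lemma ge0_integral_pdf (f h : R -> R) : is_pdf X f ->
  measurable_fun [set: R] h -> (forall x, 0 <= h x) ->
  (\int[P]_t (h (X t))%:E = \int[lebesgue_measure]_x (h x * f x)%:E)%E.
Proof.
move=> [mf f0 fE] mh h0.
have mhE : measurable_fun [set: measurableTypeR R] (EFin \o h).
  exact/measurable_EFinP.
rewrite -(ge0_integral_distribution Xb mhE)//.
exact: (ge0_integral_density _ _ _ _ (distribution P Xb) f).
Qed.

End borel_random_variable.

(** * Total mass of the record densities *)

Section record_mass.
Context {d : measure_display} {T : measurableType d} {R : realType}
  {P : probability T R}.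
Variables (X : {RV P >-> R}) (f : R -> R).
Hypothesis f_pdf : is_pdf X f.
Local Notation mu := (distribution P X).
Local Notation F := (cdfR X).
Local Notation V := (cumulative_hazard X).

Lemma is_pdf_distribution_set1 x : mu [set x] = 0%E.
Proof.
have [mf f0 ->] := f_pdf; last exact: measurable_set1.
by rewrite integral_set1.
Qed.

Lemma measurable_pdf_support : measurable (pdf_support f).
Proof.
have [mf _ _] := f_pdf.
rewrite -[X in measurable X]setTI.
rewrite (_ : pdf_support f = f @^-1` `]0, +oo[); last first.
  by apply/seteqP; split=> x /=; rewrite in_itv/= andbT.
exact: mf.
Qed.

Let hazard_rv : T -> R := V \o X.
Let measurable_hazard_rv : measurable_fun [set: T] hazard_rv.
Proof.
by apply: measurableT_comp => //; exact: measurable_cumulative_hazard.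
Qed.
HB.instance Definition _ :=
  isMeasurableFun.Build _ _ _ _ hazard_rv measurable_hazard_rv.
Let Y : {RV P >-> R} := hazard_rv.

(** It suffices to compare the tails with those of the exponential law of rate 1. *)
Lemma is_pdf_cumulative_hazard : is_pdf Y (exponential_pdf 1).
Proof.
split; [exact: measurable_exponential_pdf|move=> x; exact: exponential_pdf_ge0|].
(* The probability instance of [exponential_prob] needs a proof that the rate is
   positive, so it is not inferred. *)
apply: (eq_distribution_itvoy Y
  (exponential_distribution_exponential_prob__canonical__probability_measure_Probability ltr01)).
move=> w.
have YE z : distribution P Y `]z, +oo[ = mu [set x | z < V x].
  by congr (P _); apply/seteqP; split=> t /=; rewrite in_itv/= andbT.
rewrite YE.
have VE z : 0 <= z -> mu [set x | z < V x] = exponential_prob 1 `]z, +oo[.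
  move=> z0; rewrite exponential_prob_itvoy// mul1r.
  apply: distribution_cumulative_hazard_gt => //.
  exact: is_pdf_distribution_set1.
have [/VE//|w0] := leP 0 w.
(* Below 0 both tails equal 1: [V] is nonnegative, and the exponential law already gives mass 1 to
   []0, +oo[]. *)
transitivity (1%E : \bar R).
  rewrite (_ : [set x | w < V x] = setT) ?probability_setT//.
  apply/seteqP; split=> // x _ /=.
  exact: lt_le_trans (cumulative_hazard_ge0 _ _).
apply/esym/eqP; rewrite eq_le probability_le1//=.
rewrite -[leLHS](_ : exponential_prob 1 `]0, +oo[ = 1%E); last first.
  by rewrite exponential_prob_itvoy// mulr0 oppr0 expR0.
apply: le_measure; rewrite ?inE//.
by apply: subset_itvr; rewrite bnd_simp ltW.
Qed.

Lemma record_pdf_ge0 n k x : 0 <= record_pdf F f n k x.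
Proof.
have [_ f0 _] := f_pdf.
rewrite /record_pdf !mulr_ge0 ?exprn_ge0 ?invr_ge0 ?subr_ge0 ?cdfR_le1//.
exact: cumulative_hazard_ge0.
Qed.

Lemma measurable_record_pdf n k : measurable_fun [set: R] (record_pdf F f n k).
Proof.
have [mf _ _] := f_pdf.
apply: measurable_funM => //; apply: measurable_funM; last first.
  by apply/measurable_funX/measurable_funB => //; exact: measurable_cdfR.
apply: measurable_funM => //.
by apply: measurable_funX; exact: measurable_cumulative_hazard.
Qed.

Lemma integral_record_pdf n k : (0 < n)%N -> (0 < k)%N ->
  (\int[lebesgue_measure]_(x in pdf_support f) (record_pdf F f n k x)%:E = 1)%E.
Proof.
case: n k => // n [//|k] _ _; have [mf f0 fE] := f_pdf.
(* After the case analysis the record indices are [n.+1] and [k.+1]. The record density is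
   [phi x * f x], and [psi] is [phi] written in the variable [w = V x]. *)
pose phi x := k.+1%:R ^+ n.+1 / n`!%:R * V x ^+ n * (1 - F x) ^+ k.
pose psi (w : R) : R := k.+1%:R ^+ n.+1 / n`!%:R * w ^+ n * expR (- w) ^+ k.
have phi0 x : 0 <= phi x.
  rewrite /phi !mulr_ge0 ?exprn_ge0 ?invr_ge0 ?subr_ge0 ?cdfR_le1//.
  exact: cumulative_hazard_ge0.
have psi0 w : 0 <= w -> 0 <= psi w.
  by move=> w0; rewrite /psi !mulr_ge0 ?exprn_ge0 ?invr_ge0 ?expR_ge0.
have mphi : measurable_fun [set: R] phi.
  apply: measurable_funM; last first.
    by apply/measurable_funX/measurable_funB => //; exact: measurable_cdfR.
  apply: measurable_funM => //.
  by apply: measurable_funX; exact: measurable_cumulative_hazard.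
have mpsi : measurable_fun [set: R] psi.
  apply: measurable_funM; last first.
    by apply/measurable_funX; apply: measurableT_comp => //.
  by apply: measurable_funM => //; exact/measurable_funX.
transitivity (\int[lebesgue_measure]_x ((phi x)%:E * (f x)%:E))%E.
  rewrite integral_mkcond; apply: eq_integral => x _; rewrite patchE.
  case: ifPn => [_|]; first by rewrite -EFinM.
  rewrite notin_setE /pdf_support/= => /negP; rewrite -leNgt => fx0.
  have -> : f x = 0 by apply/eqP; rewrite eq_le fx0 f0.
  by rewrite mule0.
under eq_integral do rewrite -EFinM.
rewrite -(ge0_integral_pdf X f phi)//.
(* [V >= 0], and [psi] composed with the absolute value is nonnegative
   everywhere, as [ge0_integral_pdf] requires. *)
have psi_abs0 w : 0 <= psi `|w| by exact: psi0.
have mpsi_abs : measurable_fun [set: R] (fun w => psi `|w|).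
  by apply: (measurableT_comp mpsi); exact: normr_measurable.
(* [1 - F = expR (- V)] fails only where [F = 1], since [ln 0 = 0]. *)
transitivity (\int[P]_t (psi `|Y t|)%:E)%E.
  apply: ge0_ae_eq_integral => //.
  - by apply/measurable_EFinP; apply: measurableT_comp.
  - by apply/measurable_EFinP; apply: (measurableT_comp mpsi_abs).
  - by move=> t _; rewrite lee_fin.
  - by move=> t _; rewrite lee_fin.
  exists (X @^-1` [set x | F x = 1]); split.
  - by apply: measurable_funPTI; exact: measurable_cdfR_eq1.
  - by apply: distribution_cdfR_eq1; exact: is_pdf_distribution_set1.
  - move=> t /= /not_implyP[_]; apply: contra_notP => /eqP Fx1.
    rewrite /psi /phi ger0_norm ?cumulative_hazard_ge0//.
    by rewrite expRN_cumulative_hazard// lt_neqAle Fx1 cdfR_le1.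
rewrite (ge0_integral_pdf Y _ _ is_pdf_cumulative_hazard mpsi_abs)//.
(* The density of [Y] supplies one more factor [expR (- w)]; with [expR (- w) ^+ k] from [psi] this
   makes the Erlang density of rate [k.+1]. *)
rewrite -(integral_erlang R k.+1%:R n)// [RHS]integral_mkcond.
apply: eq_integral => w _; rewrite patchE.
rewrite /exponential_pdf patchE; case: ifPn => [|_]; last by rewrite mulr0.
rewrite inE/= in_itv/= andbT => w0; congr EFin.
rewrite ger0_norm// /psi /poisson_term.
by rewrite mulN1r -mulrN expRM_natl exprMn !exprS; ring.
Qed.
End record_mass.

(** * Comparison of integrals under a single crossing *)

(** The disjunctions exclude [oo - oo]. If [a'] is infinite, then [a] is finite and the left side is
    [-oo]; if [a'] is finite, the inequality of sums forces [b'] to be finite too. *)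
Lemma leeB_of_leeD (R : realType) (a a' b b' : \bar R) :
  (0 <= a -> 0 <= a' -> 0 <= b -> 0 <= b' ->
  a < +oo \/ a' < +oo -> b < +oo \/ b' < +oo ->
  a + b' <= b + a' -> a - a' <= b - b')%E.
Proof.
move=> a0 a'0 b0 b'0 wa wb.
case: a' => [a'| |] // in a'0 wa *; last first.
  by case: wa => //; case: a a0 => [a| |] //= _ _ _; exact: leNye.
case: b' => [b'| |] // in b'0 wb *.
  by move=> abab; rewrite leeBlDr// addeAC leeBrDr.
case: wb => //; case: b b0 => [b| |] // _ _.
by case: a {wa} a0.
Qed.

(** Formally, integrating the pointwise inequality leaves [c] times the difference of the masses of
    [q] and [p], which is 0. As [p L] and [q L] may have infinite integrals, the computation is
    carried out on nonnegative parts. *)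
Lemma le_integral_single_crossing (d : measure_display) (T : measurableType d)
    (R : realType) (mu : {measure set T -> \bar R}) (D : set T)
    (p q L : T -> R) (c : R) :
  let a := fun x => (p x * L x)%:E in let b := fun x => (q x * L x)%:E in
  measurable D -> measurable_fun D p -> measurable_fun D q ->
  measurable_fun D L -> (forall x, 0 <= p x) -> (forall x, 0 <= q x) ->
  (\int[mu]_(x in D) (p x)%:E < +oo)%E ->
  (\int[mu]_(x in D) (q x)%:E = \int[mu]_(x in D) (p x)%:E)%E ->
  {ae mu, forall x, D x -> p x * (L x - c) <= q x * (L x - c)} ->
  (\int[mu]_(x in D) a^\+ x < +oo \/ \int[mu]_(x in D) a^\- x < +oo)%E ->
  (\int[mu]_(x in D) b^\+ x < +oo \/ \int[mu]_(x in D) b^\- x < +oo)%E ->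
  (\int[mu]_(x in D) a x <= \int[mu]_(x in D) b x)%E.
Proof.
move=> a b mD mp mq mL p0 q0 pfin qp pq wda wdb.
have ma : measurable_fun D a by exact/measurable_EFinP/measurable_funM.
have mb : measurable_fun D b by exact/measurable_EFinP/measurable_funM.
pose cp := Num.max c 0; pose cm := Num.max (- c) 0.
have cp0 : 0 <= cp by rewrite le_max lexx orbT.
have cm0 : 0 <= cm by rewrite le_max lexx orbT.
have cE : c = cp - cm.
  by rewrite /cp /cm; case: (leP c 0) => ?; case: (leP (- c) 0) => ?; lra.
(* Moving the negative parts, and those of [c p] and [c q], to the other side
   leaves an inequality between integrals of nonnegative functions. *)
pose mix (u v : T -> R) (x : T) := (cp * u x + cm * v x)%:E.
have mmix (u v : T -> R) : measurable_fun D u -> measurable_fun D v ->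
    measurable_fun D (mix u v).
  move=> mu' mv; apply/measurable_EFinP/measurable_funD.
    exact: measurable_funM.
  exact: measurable_funM.
have mix0 (u v : T -> R) : (forall x, 0 <= u x) -> (forall x, 0 <= v x) ->
    forall x, (0 <= mix u v x)%E.
  by move=> u0 v0 x; rewrite lee_fin addr_ge0// mulr_ge0.
have int_mix (u v : T -> R) : measurable_fun D u -> measurable_fun D v ->
    (forall x, 0 <= u x) -> (forall x, 0 <= v x) ->
    (\int[mu]_(x in D) mix u v x =
     cp%:E * \int[mu]_(x in D) (u x)%:E + cm%:E * \int[mu]_(x in D) (v x)%:E)%E.
  move=> mu' mv u0 v0; rewrite -!ge0_integralZl//; first last.
  - by move=> x _; rewrite lee_fin.
  - exact/measurable_EFinP.
  - by move=> x _; rewrite lee_fin.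
  - exact/measurable_EFinP.
  rewrite -ge0_integralD//.
  - by move=> x _; rewrite -EFinM lee_fin mulr_ge0.
  - by apply/measurable_EFinP/measurable_funM.
  - by move=> x _; rewrite -EFinM lee_fin mulr_ge0.
  - by apply/measurable_EFinP/measurable_funM.
have int3 (g h k : T -> \bar R) :
    measurable_fun D g -> measurable_fun D h -> measurable_fun D k ->
    (forall x, 0 <= g x)%E -> (forall x, 0 <= h x)%E ->
    (forall x, 0 <= k x)%E ->
    (\int[mu]_(x in D) (g x + h x + k x) = \int[mu]_(x in D) g x +
      \int[mu]_(x in D) h x + \int[mu]_(x in D) k x)%E.
  move=> mg mh mk g0 h0 k0; rewrite !ge0_integralD//.
  - by move=> x _; rewrite adde_ge0.
  - exact: emeasurable_funD.
rewrite integralE [leRHS]integralE.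
apply: leeB_of_leeD => //; try by apply: integral_ge0.
(* [mix q p] and [mix p q] have the same finite integral, so one can be added on each side. Their
   difference restores [c * (q x - p x)] with nonnegative terms only. *)
have fin_mix : (\int[mu]_(x in D) mix q p x)%E \is a fin_num.
  rewrite int_mix// qp.
  have ? : (\int[mu]_(x in D) (p x)%:E)%E \is a fin_num.
    by rewrite ge0_fin_numE//; apply: integral_ge0 => x _; rewrite lee_fin.
  by rewrite fin_numD !fin_numM.
rewrite -(leeD2rE _ _ fin_mix).
have {2}-> : (\int[mu]_(x in D) mix q p x = \int[mu]_(x in D) mix p q x)%E.
  by rewrite !int_mix// qp.
have mpos g : measurable_fun D g -> measurable_fun D (g^\+)%E.
  exact: measurable_funepos.
have mneg g : measurable_fun D g -> measurable_fun D (g^\-)%E.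
  exact: measurable_funeneg.
rewrite -!int3//; [|by auto..].
apply: ae_ge0_le_integral => //.
- by move=> x _; rewrite !adde_ge0 ?mix0.
- by apply: emeasurable_funD; [apply: emeasurable_funD|]; auto.
- by move=> x _; rewrite !adde_ge0 ?mix0.
- by apply: emeasurable_funD; [apply: emeasurable_funD|]; auto.
case: pq => N [mN N0 pqN]; exists N; split => //.
apply: subset_trans pqN; apply: subsetC => x /= H Dx.
have {H} := H Dx.
rewrite !funeposE !funenegE /a /b /mix -!EFinN -!EFin_max -!EFinD.
rewrite lee_fin cE.
(* Replacing each positive part by the negative part plus the function cancels the negative parts
   and leaves the pointwise hypothesis, rearranged. *)
have maxE (u : R) : Num.max u 0 = Num.max (- u) 0 + u.
  by case: (leP u 0) => ?; case: (leP (- u) 0) => ?; lra.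
rewrite (maxE (p x * L x)) (maxE (q x * L x)); lra.
Qed.

(** * Monotonicity of the inaccuracy in [n] *)

Lemma pdf_support_nonempty (d : measure_display) (T : measurableType d)
    (R : realType) (P : probability T R) (X : {RV P >-> R}) (f : R -> R)
    (A : set R) :
  is_pdf X f -> measurable A -> distribution P X A != 0%E ->
  exists2 x, A x & pdf_support f x.
Proof.
move=> [mf f0 fE] mA; rewrite fE//; apply: contra_neqP => /forall2NP AS.
apply: integral0_eq => x Ax; have [//|/negP] := AS x.
rewrite /pdf_support/= -leNgt => fx0.
by congr EFin; apply/eqP; rewrite eq_le fx0 f0.
Qed.

Lemma record_pdfS (R : realType) (F f : R -> R) (n k : nat) (x : R) :
  (0 < n)%N ->
  record_pdf F f n.+1 k x =
  record_pdf F f n k x * (k%:R * (- ln (1 - F x)) / n%:R).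
Proof.
case: n => // n _; rewrite /record_pdf /= factS natrM invfM !exprS.
by ring.
Qed.

Lemma cdfR_le_hazard (d : measure_display) (T : measurableType d)
    (R : realType) (P : probability T R) (X : {RV P >-> R}) (w x : R) :
  cdfR X x < 1 -> (cdfR X x <= 1 - expR (- w)) = (cumulative_hazard X x <= w).
Proof.
move=> Fx1; rewrite -[RHS]lerN2 -[RHS]ler_expR expRN_cumulative_hazard//.
by rewrite lerBrDr addrC -lerBrDr.
Qed.

Theorem theorem2 (d : measure_display) (T : measurableType d) (R : realType)
    (P : probability T R) (X : {RV P >-> R}) (f : R -> R)
    (f_pdf : is_pdf X f)
    (F_cont : {within pdf_support f, continuous (cdfR X)})
    (F_incr : forall x y : R, pdf_support f x -> pdf_support f y ->
      x < y -> cdfR X x < cdfR X y)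
    (k : nat) (k_ge1 : (1 <= k)%N)
    (f_incr : forall x y : R, pdf_support f x -> pdf_support f y ->
      x <= y -> f x <= f y) :
  forall n : nat, (1 <= n)%N ->
    kerridge_well_defined (record_pdf (cdfR X) f n k) f ->
    kerridge_well_defined (record_pdf (cdfR X) f n.+1 k) f ->
    (kerridge (record_pdf (cdfR X) f n.+1 k) f <=
       kerridge (record_pdf (cdfR X) f n k) f)%E.
Proof.
move=> n n1 wdn wdn1; rewrite /kerridge leeN2.
have [mf _ _] := f_pdf.
have n0 : 0 < n%:R :> R by rewrite ltr0n.
have k0 : 0 < k%:R :> R by rewrite ltr0n.
have mu1 := is_pdf_distribution_set1 X f f_pdf.
(* The ratio [k V / n] of consecutive record densities equals 1 at [V = w], that is, at [F = t]. *)
pose w : R := n%:R / k%:R; pose t : R := 1 - expR (- w).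
have t01 : 0 < t < 1.
  by rewrite subr_gt0 expR_lt1 oppr_lt0 divr_gt0//= ltrBlDr ltrDl expR_gt0.
(* Both sides of the crossing have positive mass and so meet the support: [a] will make [lows]
   nonempty, and [b] will bound it above. *)
have [a at_ aS] : exists2 x, cdfR X x <= t & pdf_support f x.
  apply: (pdf_support_nonempty _ _ _ _ X f _ f_pdf (measurable_cdfR_le X t)).
  by rewrite distribution_cdfR_le//; case/andP: t01 => t0 _; rewrite eqe gt_eqF.
have [b tb bS] : exists2 x, t < cdfR X x & pdf_support f x.
  apply: (pdf_support_nonempty _ _ _ _ X f _ f_pdf (measurable_cdfR_gt X t)).
  rewrite distribution_cdfR_gt//; case/andP: t01 => _ t1.
  by rewrite eqe gt_eqF ?subr_gt0.
have ln_incr x y : pdf_support f x -> pdf_support f y ->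
    cdfR X x <= t -> t < cdfR X y -> ln (f x) <= ln (f y).
  move=> xS yS xt ty; rewrite ler_ln ?posrE//; apply: f_incr => //.
  rewrite leNgt; apply/negP => /ltW /(cdfR_nondecreasing X).
  by rewrite leNgt (le_lt_trans xt).
pose lows := [set ln (f x) | x in [set x | pdf_support f x /\ cdfR X x <= t]].
pose c := sup lows.
have lowc x : pdf_support f x -> cdfR X x <= t -> ln (f x) <= c.
  move=> xS xt; apply: ub_le_sup; last by exists x.
  by exists (ln (f b)) => _ [y [yS yt] <-]; exact: ln_incr.
have cup x : pdf_support f x -> t < cdfR X x -> c <= ln (f x).
  move=> xS tx; apply: ge_sup; first by exists (ln (f a)); exists a.
  by move=> _ [y [yS yt] <-]; exact: ln_incr.
apply: (le_integral_single_crossing _ _ _ lebesgue_measure _ _ _ _ c) => //.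
- exact: (measurable_pdf_support X f f_pdf).
- by apply: measurable_funTS; exact: (measurable_record_pdf X f f_pdf).
- by apply: measurable_funTS; exact: (measurable_record_pdf X f f_pdf).
- by apply: measurable_funTS; apply: measurableT_comp mf.
- exact: record_pdf_ge0.
- exact: record_pdf_ge0.
- by rewrite (integral_record_pdf X f f_pdf)// ltry.
- by rewrite !(integral_record_pdf X f f_pdf).
(* Where [F x = 1] the computed ratio is 0 instead of infinite, so the sign argument fails there.
   Strict monotonicity of [F] on the support leaves at most one such point. *)
pose N := pdf_support f `&` [set x | cdfR X x = 1].
have N0 : lebesgue_measure.-negligible N.
  have [[x0 [x0S Fx0]]|nN] := pselect (N !=set0).
    exists [set x0].
    split; [exact: measurable_set1|exact: lebesgue_measure_set1|].
    move=> x [xS Fx] /=; have [xx0|xx0|//] := ltgtP x x0.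
    + by have := F_incr _ _ xS x0S xx0; rewrite Fx Fx0 ltxx.
    + by have := F_incr _ _ x0S xS xx0; rewrite Fx Fx0 ltxx.
  by move/nonemptyPn: nN => ->; exact: negligible_set0.
apply: negligibleS N0 => x /= /not_implyP[xS]; apply: contra_notP => Fx.
have {}Fx : cdfR X x < 1.
  by rewrite lt_neqAle cdfR_le1 andbT; apply/eqP => Fx1; apply: Fx.
rewrite record_pdfS// -mulrA ler_wpM2l ?(record_pdf_ge0 X f f_pdf)//.
rewrite -subr_ge0 -[X in _ - X]mul1r -mulrBl.
rewrite -/(cumulative_hazard X x).
have ratio1 : (k%:R * cumulative_hazard X x / n%:R <= 1) = (cdfR X x <= t).
  by rewrite cdfR_le_hazard// ler_pdivrMr// mul1r mulrC -ler_pdivlMr.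
(* The goal is now that the ratio minus 1, times [ln (f x) - c], is nonnegative: both factors are at
   most 0 up to the crossing and at least 0 after it. *)
have [xt|tx] := leP (cdfR X x) t.
  by rewrite mulr_le0 ?subr_le0 ?ratio1 ?lowc.
by rewrite mulr_ge0// subr_ge0 ?cup// ltW// ltNge ratio1 -ltNge.
Qed.
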